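(* Let $\mu$ be a probability measure on bi-infinite simple paths in the square lattice $\mathbb{Z}^2$. Assume that $\mu$ is invariant and ergodic with respect to the group of $\mathbb{Z}^2$-translations, and that $\mu$ is invariant under the group of rotations of the plane around the origin by integer multiples of $\pi/2$. Then for $\mu$-almost every path $P$, for every direction of $P$ and every vertex $v=(a,b)$ of $P$, the past of $v$ intersects the upward vertical ray $\{(a,t): t>b\}$ infinitely many times. The same holds with the upward ray replaced by any of the other axis-parallel rays starting at $v$, namely $\{(a,t): t<b\}$, $\{(t,b): t>a\}$, $\{(t,b): t<a\}$, and with the past of $v$ replaced by the future of $v$.
   Context: $\mathbb{Z}^2$ is the standard nearest-neighbour square lattice graph. A bi-infinite (two-sided infinite) simple path $P=(V(P),E(P))$ is a subgraph isomorphic to the graph $\mathbb{Z}$. A direction of $P$ is a bijection $t:V(P)\to\mathbb{Z}$ such that two vertices are neighbours in $P$ iff their images are consecutive integers. Given a direction $t$, the past of $v\in V(P)$ is $\{u\in V(P): t(u)<t(v)\}$ and the future of $v$ is $\{u\in V(P): t(u)>t(v)\}$. A set of path vertices intersects a ray infinitely many times if infinitely many of its vertices lie on the ray. *)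

(* Defs.v *)
From HB Require Import structures.
From mathcomp Require Import all_boot all_order all_algebra.
From mathcomp Require Import all_classical all_reals all_analysis.

Set Implicit Arguments.
Unset Strict Implicit.
Unset Printing Implicit Defensive.
Import Order.TTheory GRing.Theory Num.Theory.
Local Open Scope classical_set_scope.
Local Open Scope ring_scope.

Notation Z2 := (int * int)%type.

Definition lattice_adj (u v : Z2) : bool :=
  `|u.1 - v.1| + `|u.2 - v.2| == 1.

(* The values of t outside V are irrelevant. *)
Definition is_direction (V : set Z2) (E : set (Z2 * Z2)) (t : Z2 -> int) :=
  set_bij V [set: int] t /\
  (forall u v, V u -> V v -> (E (u, v) <-> `|t u - t v| = 1)).

(* An unordered edge {u, v} is encoded by both pairs (u, v) and (v, u). *)
Record bipath := Bipath {
  pathV : set Z2;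
  pathE : set (Z2 * Z2);
  pathE_sym : forall u v, pathE (u, v) -> pathE (v, u);
  pathE_sub : forall u v, pathE (u, v) -> [/\ pathV u, pathV v & lattice_adj u v];
  path_iso : exists t, is_direction pathV pathE t }.

Definition direction (P : bipath) (t : Z2 -> int) :=
  is_direction (pathV P) (pathE P) t.

Definition past (P : bipath) (t : Z2 -> int) (v : Z2) : set Z2 :=
  [set u | pathV P u /\ t u < t v].

Definition future (P : bipath) (t : Z2 -> int) (v : Z2) : set Z2 :=
  [set u | pathV P u /\ t v < t u].

Definition ray_up (v : Z2) : set Z2 := [set (v.1, s) | s in [set s | v.2 < s]].
Definition ray_down (v : Z2) : set Z2 := [set (v.1, s) | s in [set s | s < v.2]].
Definition ray_right (v : Z2) : set Z2 := [set (s, v.2) | s in [set s | v.1 < s]].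
Definition ray_left (v : Z2) : set Z2 := [set (s, v.2) | s in [set s | s < v.1]].

Section path_image.
Variables (f : Z2 -> Z2) (fbij : bijective f).
Variable fadj : forall u v, lattice_adj (f u) (f v) = lattice_adj u v.
Variable P : bipath.

Let V := f @` pathV P.
Let E := [set (f e.1, f e.2) | e in pathE P].

Lemma path_image_sym u v : E (u, v) -> E (v, u).
Proof. by move=> [[a b] /pathE_sym Eba [<- <-]]; exists (b, a). Qed.

Lemma path_image_sub u v : E (u, v) -> [/\ V u, V v & lattice_adj u v].
Proof.
move=> [[a b] /pathE_sub[Va Vb ab] [<- <-]] /=.
by split; [exists a|exists b|rewrite fadj].
Qed.

Lemma path_image_iso : exists t, is_direction V E t.
Proof.
case: (path_iso P) => t [[_ tinj tsurj] tE].
case: fbij => g fK gK; exists (t \o g); split.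
  split=> //.
  - move=> _ _ /set_mem[a Va <-] /set_mem[b Vb <-] /=; rewrite !fK => tab.
    by congr f; apply: tinj => //; exact: mem_set.
  - move=> n /tsurj[a Va <-]; exists (f a); first by exists a.
    by rewrite /= fK.
move=> _ _ [a Va <-] [b Vb <-] /=; rewrite !fK -tE//; split.
  by move=> [[c d] /= cd [/(can_inj fK) <- /(can_inj fK) <-]].
by move=> ab; exists (a, b).
Qed.

Definition path_image : bipath :=
  Bipath path_image_sym path_image_sub path_image_iso.

End path_image.

Definition shift (z u : Z2) : Z2 := (u.1 + z.1, u.2 + z.2).

Lemma shift_bij z : bijective (shift z).
Proof.
by exists (shift (- z.1, - z.2)) => -[x y]; rewrite /shift /= ?addrK ?subrK.
Qed.

Lemma shift_adj z u v : lattice_adj (shift z u) (shift z v) = lattice_adj u v.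
Proof. by rewrite /lattice_adj /shift /= !opprD !(addrACA _ z.1) !(addrACA _ z.2) !subrr !addr0. Qed.

Definition translate (z : Z2) : bipath -> bipath :=
  path_image (shift_bij z) (shift_adj z).

Definition rot (u : Z2) : Z2 := (- u.2, u.1).

Lemma rot_bij : bijective rot.
Proof. by exists (fun u => (u.2, - u.1)) => -[x y]; rewrite /rot /= opprK. Qed.

Lemma rot_adj u v : lattice_adj (rot u) (rot v) = lattice_adj u v.
Proof. by rewrite /lattice_adj /rot /= -opprD normrN addrC. Qed.

(* Rotation by k * (pi / 2); this group has order 4, so k : nat suffices. *)
Definition rotate_path (k : nat) : bipath -> bipath :=
  iter k (path_image rot_bij rot_adj).

(* A measurableType must be pointed: the horizontal axis is the chosen path. *)
Section axis_path.
Let V : set Z2 := [set u | u.2 = 0].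
Let E : set (Z2 * Z2) := [set e | [/\ V e.1, V e.2 & lattice_adj e.1 e.2]].

Lemma axis_path_sym u v : E (u, v) -> E (v, u).
Proof.
move=> [Vu Vv uv]; split=> //=; move: uv.
by rewrite /lattice_adj /= distrC [X in _ + X]distrC.
Qed.

Lemma axis_path_iso : exists t, is_direction V E t.
Proof.
exists fst; split.
  split=> //.
  - by move=> [a b] [c d] /set_mem; rewrite /V /= => -> /set_mem /= -> ->.
  - by move=> n _; exists (n, 0).
move=> [a b] [c d]; rewrite /V /= => -> ->.
rewrite /E /V /lattice_adj /= subrr normr0 addr0.
by split=> [[_ _ /eqP]|/eqP].
Qed.

Definition axis_path : bipath := Bipath axis_path_sym (fun u v h => h) axis_path_iso.
End axis_path.

HB.instance Definition _ := gen_eqMixin bipath.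
HB.instance Definition _ := gen_choiceMixin bipath.
HB.instance Definition _ := isPointed.Build bipath axis_path.

(* Generators of the trace on bipath of the product sigma-algebra of
   configurations in {0, 1}^(vertices + edges). *)
Definition path_cylinders : set (set bipath) :=
  [set [set P | pathV P v] | v in [set: Z2]] `|`
  [set [set P | pathE P e] | e in [set: Z2 * Z2]].

Notation path_space := (g_sigma_algebraType path_cylinders).

Definition translation_invariant (R : realType) (mu : probability path_space R) :=
  forall (z : Z2) (A : set path_space), measurable A ->
    mu (translate z @^-1` A) = mu A.

Definition translation_ergodic (R : realType) (mu : probability path_space R) :=
  forall A : set path_space, measurable A ->
    (forall z : Z2, translate z @^-1` A = A) ->
    mu A = 0%E \/ mu A = 1%E.

Definition rotation_invariant (R : realType) (mu : probability path_space R) :=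
  forall (k : nat) (A : set path_space), measurable A ->
    mu (rotate_path k @^-1` A) = mu A.

(* Main.v *)
(* Fix a bi-infinite walk p along P; its past is one end of P, its future the
   other. Suppose the past avoids the right side of some row, in the sense that
   it visits the row only finitely often far to the right. By Poincare
   recurrence the record vertices of that row (those whose past does not meet
   the ray to their right) extend to the left forever and are visited in this
   order, so the past hits the left side infinitely often. By planarity the rows
   whose right side is avoided by the past form an interval, and by recurrence
   this interval has no boundary row. Hence "right" is avoided by one end on all
   rows, and "left", if avoided, by the other end. If avoidance has positive
   probability, ergodicity and rotation invariance force it almost surely in all
   four directions; then exactly one of the events "right and up are avoided by
   the same end" and its image under the quarter turn occurs. These events have
   the same probability, which is 0 or 1 by ergodicity: a contradiction. *)
Require Import Defs.
From mathcomp Require Import all_boot all_order all_algebra.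
From mathcomp Require Import all_classical all_reals all_analysis.
From mathcomp Require Import zify.
Import Order.TTheory GRing.Theory Num.Theory.
Local Open Scope classical_set_scope.
Local Open Scope ring_scope.

(** * Walks in the lattice *)

Definition walk (p : int -> Z2) :=
  injective p /\ forall n, lattice_adj (p n) (p (n + 1)).

Definition rev (p : int -> Z2) (n : int) : Z2 := p (- n).

(** By [past_avoids_right_from] the choice of [N] is immaterial, so this is a property of the end
    that [p] comes from, insensitive to the origin of time. *)
Definition past_avoids_right (p : int -> Z2) (b : int) :=
  exists N M : int, forall n : int, n <= N -> (p n).2 = b -> (p n).1 <= M.

Definition past_avoids_left (p : int -> Z2) (b : int) :=
  exists N M : int, forall n : int, n <= N -> (p n).2 = b -> M <= (p n).1.

Definition record (p : int -> Z2) (i : int) :=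
  forall m, m < i -> (p m).2 = (p i).2 -> (p m).1 <= (p i).1.

Definition boundary_row (p : int -> Z2) (b : int) :=
  ~ past_avoids_right p (b + 1) \/ ~ past_avoids_right p (b - 1).

(** A record certifies by [record_avoids] that its own row is avoided. Thus an avoided row next to
    one that is not avoided turns into a property of single vertices, to which recurrence
    applies. *)
Definition boundary_record (p : int -> Z2) (i : int) :=
  record p i /\ boundary_row p (p i).2.

(** A path determines its walk only up to a shift and a reversal of time, so an event of the path
    cannot name one of the two ends. Position [i] of [p] is position [- i] of [rev p]. *)
Definition either_end (Q : (int -> Z2) -> int -> Prop) (p : int -> Z2) (i : int) :=
  Q p i \/ Q (rev p) (- i).

(** The three consequences of Poincare recurrence that the deterministic argument uses, for
    translations to the right, to the left and upwards. *)
Definition recurrent (p : int -> Z2) :=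
  [/\ forall i N, exists j, (p j).2 = (p i).2 /\ N <= (p j).1,
      forall i, either_end record p i -> forall N,
        exists j, [/\ either_end record p j, (p j).2 = (p i).2 & (p j).1 <= N] &
      forall i, either_end boundary_record p i -> forall N,
        exists j, either_end boundary_record p j /\ N <= (p j).2].

Lemma revK p : rev (rev p) = p.
Proof. by apply/funext => n; rewrite /rev opprK. Qed.

Lemma either_end_rev Q p i : either_end Q (rev p) i = either_end Q p (- i).
Proof.
by rewrite /either_end revK opprK; apply/propext; split=> -[]; [right|left|right|left].
Qed.

Lemma walk_rev {p} : walk p -> walk (rev p).
Proof.
move=> [pinj padj]; split=> [m n /pinj/oppr_inj //|n].
have := padj (- (n + 1)); rewrite /rev.
have -> : - (n + 1) + 1 = - n by lia.
rewrite /lattice_adj; lia.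
Qed.

Lemma recurrent_rev {p} : recurrent p -> recurrent (rev p).
Proof.
move=> [h1 h2 h3]; split=> i.
- by move=> N; have [j] := h1 (- i) N; exists (- j); rewrite /rev opprK.
- rewrite either_end_rev => /h2 h N; have [j [rj ? ?]] := h N.
  by exists (- j); rewrite either_end_rev /rev opprK.
- rewrite either_end_rev => /h3 h N; have [j [rj ?]] := h N.
  by exists (- j); rewrite either_end_rev /rev opprK.
Qed.

Lemma walk_lipschitz {p : int -> Z2} : walk p -> forall m n,
  `|(p m).1 - (p n).1| <= `|m - n| /\ `|(p m).2 - (p n).2| <= `|m - n|.
Proof.
move=> [_ padj].
have step (k : nat) n : `|(p (n + k%:Z)).1 - (p n).1| <= k%:Z /\
    `|(p (n + k%:Z)).2 - (p n).2| <= k%:Z.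
  elim: k => [|k IH]; first by rewrite addr0; lia.
  have := padj (n + k%:Z); rewrite /lattice_adj.
  have -> : n + k%:Z + 1 = n + k.+1%:Z by lia.
  lia.
move=> m n; have [mn|/ltW mn] := lerP n m.
  by have := step `|m - n|%N n; have -> : n + `|m - n|%N%:Z = m by [lia]; lia.
by have := step `|m - n|%N m; have -> : m + `|m - n|%N%:Z = n by [lia]; lia.
Qed.

Lemma finite_int_interval (a : int) : finite_set [set x : int | `|x| <= a].
Proof.
apply: (@sub_finite_set _ _ ((fun k : nat => k%:Z - a) @` `I_(`|a|%N.*2.+1))).
  by move=> x /= xa; exists `|(x + a)%R|%N => /=; lia.
exact/finite_image/finite_II.
Qed.

Lemma finite_int_lower_bound (S : set int) :
  finite_set S -> exists N : int, forall n : int, n <= N -> ~ S n.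
Proof.
move=> /finite_seqP[s ->]; elim: s => [|x s [N IH]]; first by exists 0.
exists (Order.min N (x - 1)) => n nN /=; rewrite inE => /orP[/eqP nx|ns]; first by lia.
by apply: (IH n) => //; lia.
Qed.

Lemma past_leaves_box {p : int -> Z2} : injective p -> forall a : int,
  exists N : int, forall n : int, n <= N -> ~ (`|(p n).1| <= a /\ `|(p n).2| <= a).
Proof.
move=> pinj a; apply: (@finite_int_lower_bound
  (p @^-1` ([set x : int | `|x : int| <= a] `*` [set x : int | `|x : int| <= a]))).
apply: finite_preimage; first by move=> ? ? _ _; exact: pinj.
by apply: finite_setX; exact: finite_int_interval.
Qed.

(** Between times [N0] and [N] the walk stays within [|N - N0|] of [p N], so a larger bound absorbs
    this stretch. *)
Lemma past_avoids_right_from {p : int -> Z2} {b} : walk p -> past_avoids_right p b ->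
  forall N : int, exists M : int, forall n : int, n <= N -> (p n).2 = b -> (p n).1 <= M.
Proof.
move=> wp [N0 [M0 h]] N.
exists (Order.max M0 ((p N).1 + `|N - N0|)) => n nN nb.
have [nN0|nN0] := lerP n N0; first by have := h n nN0 nb; lia.
have := walk_lipschitz wp n N; lia.
Qed.

Lemma past_avoids_right_not {p : int -> Z2} {b} : ~ past_avoids_right p b ->
  forall N M, exists n, [/\ n <= N, (p n).2 = b & M < (p n).1].
Proof.
move=> h N M; apply: contrapT => h'; apply: h; exists N, M => n nN nb.
by rewrite leNgt; apply/negP => Mn; apply: h'; exists n.
Qed.

Lemma past_avoids_left_not {p : int -> Z2} {b} : ~ past_avoids_left p b ->
  forall N M, exists n, [/\ n <= N, (p n).2 = b & (p n).1 < M].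
Proof.
move=> h N M; apply: contrapT => h'; apply: h; exists N, M => n nN nb.
by rewrite leNgt; apply/negP => Mn; apply: h'; exists n.
Qed.

Lemma record_avoids {p i} : record p i -> past_avoids_right p (p i).2.
Proof. by move=> h; exists (i - 1), (p i).1 => n ni; apply: h; lia. Qed.

(** As long as the vertex is no record, some earlier vertex of the row lies further right. The bound
    [M] on the row stops this search; [k] measures the room left before [M]. *)
Lemma avoids_record {p : int -> Z2} i : walk p -> past_avoids_right p (p i).2 ->
  exists j, record p j /\ (p j).2 = (p i).2.
Proof.
move=> wp /(past_avoids_right_from wp)/(_ i)[M hM].
suff h (k : nat) j : j <= i -> (p j).2 = (p i).2 -> M - (p j).1 <= k%:Z ->
    exists j, record p j /\ (p j).2 = (p i).2.
  by apply: (h `|M - (p i).1|%N i) => //; lia.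
elim: k j => [|k IH] j ji jb jM.
  exists j; split=> // m mj; rewrite jb => mb.
  by have := hM m _ mb; lia.
have [//|/existsNP[m /not_implyP[mj /not_implyP[mb mx]]]] := pselect (record p j).
  by exists j.
by apply: (IH m); [lia|rewrite mb|lia].
Qed.

(** * A single row of a recurrent walk *)

Section recurrent_walk.
Variable p : int -> Z2.
Hypotheses (wp : walk p) (rp : recurrent p).

(** If both ends avoided the right, the visits to the row would be bounded on the right, against the
    first clause of [recurrent]. *)
Lemma avoids_right_one_end i : past_avoids_right p (p i).2 ->
  past_avoids_right (rev p) (p i).2 -> False.
Proof.
move=> /(past_avoids_right_from wp)/(_ 0)[M1 h1].
move=> /(past_avoids_right_from (walk_rev wp))/(_ 0)[M2 h2].
have [h _ _] := rp; have [j [jb jM]] := h i (Order.max M1 M2 + 1).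
have [j0|j0] := lerP j 0; first by have := h1 j j0 jb; lia.
by have := h2 (- j); rewrite /rev opprK => /(_ _ jb); lia.
Qed.

(* The record vertices of a row are visited from left to right, and by
   recurrence they extend infinitely far to the left. *)
Lemma avoids_right_hits_left i : past_avoids_right p (p i).2 ->
  ~ past_avoids_left p (p i).2.
Proof.
move=> ai [N [M hM]].
have [k [rk kb]] := avoids_record i wp ai.
have [_ h _] := rp.
(* The target lies left of [M] and too far from [p k] to be reached in [|k - N|] steps, so a record
   [j] of [p] there satisfies neither [j <= N] nor [N < j]. A record of [rev p] would make the other
   end avoid the right too. *)
have [j [[rj|rj] jb jx]] := h k (or_introl rk)
  (- `|M| - `|k - N| - `|(p k).1| - 1); last first.
  have := record_avoids rj; rewrite /rev opprK jb kb.
  by move/(avoids_right_one_end i ai).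
have jk : j < k.
  rewrite ltNge; apply/negP => kj.
  have [kj'|jek] := ltP k j; first by have := rj k kj' (esym jb); lia.
  by have jk : j = k by [lia]; subst j; lia.
have [jN|jN] := lerP j N; first by have := hM j jN; rewrite jb => /(_ kb); lia.
have := walk_lipschitz wp j k; lia.
Qed.

End recurrent_walk.

(** * From one row to all rows *)

Lemma every_row {p} : walk p -> (forall N, exists n, N <= (p n).2) ->
  (forall N, exists n, (p n).2 <= N) -> forall b, exists i, (p i).2 = b.
Proof.
move=> wp hi lo b; have [m mb] := lo b; have [n bn] := hi b.
suff h (k : nat) m0 : `|m0 - n| <= k%:Z -> (p m0).2 <= b -> exists i, (p i).2 = b.
  by apply: (h `|m - n|%N m) => //; lia.
elim: k m0 => [|k IH] m0 mn m0b.
  by have -> : b = (p n).2; [have m0n : m0 = n by [lia]; subst m0; lia|exists n].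
have [e|ne] := eqVneq (p m0).2 b; first by exists m0.
have [le|gt] := lerP m0 n.
  have [e|ne'] := eqVneq m0 n; first by subst m0; exfalso; lia.
  by apply: (IH (m0 + 1)); [lia|have := walk_lipschitz wp (m0 + 1) m0; lia].
by apply: (IH (m0 - 1)); [lia|have := walk_lipschitz wp (m0 - 1) m0; lia].
Qed.

(* Far from the origin the past cannot cross the short left side of the half
   strip bounded by the two outer rows, so it would stay inside forever. *)
Lemma half_strip_trap {p : int -> Z2} {b1 b b2 : int} : walk p -> b1 < b -> b < b2 ->
  past_avoids_right p b1 -> past_avoids_right p b2 ->
  ~ past_avoids_left p b1 -> past_avoids_right p b.
Proof.
move=> wp b1b bb2 /(past_avoids_right_from wp)/(_ 0)[M1 h1].
move=> /(past_avoids_right_from wp)/(_ 0)[M2 h2] hl.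
apply: contrapT => hb.
have [M [M1M M2M]] : exists M, M1 <= M /\ M2 <= M by exists (Order.max M1 M2); lia.
have [pinj padj] := wp.
(* This box contains the column [M + 1] of the strip, so before [N] the walk cannot step out through
   the left side. The bounds [h1] and [h2], valid at times up to [0], close the two outer rows. *)
have [N hN] := past_leaves_box pinj (`|M| + `|b1| + `|b2| + 2).
pose inside (n : int) := [/\ b1 < (p n).2, (p n).2 < b2 & M < (p n).1].
have [n [nN nb nM]] := past_avoids_right_not hb (Order.min N 0) M.
have inside_n (k : nat) : inside (n - k%:Z).
  elim: k => [|k]; first by rewrite subr0; split; lia.
  have -> : n - k%:Z = n - k.+1%:Z + 1 by lia.
  set m := n - k.+1%:Z; have mn : m + 1 <= Order.min N 0 by lia.
  move=> [i1 i2 i3]; have := padj m; rewrite /lattice_adj => adj.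
  have := hN (m + 1); have := h1 m; have := h2 m; rewrite /inside; split; lia.
(* The past still has to visit row [b1], which [inside] excludes. *)
have [m [mn mb mM]] := past_avoids_left_not hl n 0.
have := inside_n `|n - m|%N; rewrite /inside.
by have -> : n - `|n - m|%N%:Z = m by [lia]; case; lia.
Qed.

Section all_rows.
Variable p : int -> Z2.
Hypotheses (wp : walk p) (rp : recurrent p) (rows : forall b, exists i, (p i).2 = b).

Lemma avoids_right_convex b1 b b2 : past_avoids_right p b1 ->
  past_avoids_right p b2 -> b1 <= b -> b <= b2 -> past_avoids_right p b.
Proof.
move=> a1 a2; rewrite le_eqVlt => /orP[/eqP <- //|lt1].
rewrite le_eqVlt => /orP[/eqP -> //|lt2].
apply: (half_strip_trap wp lt1 lt2) => //.
by have [i ib] := rows b1; move: a1; rewrite -ib; exact: avoids_right_hits_left.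
Qed.

(** Of three avoided rows, the neighbours of the middle one lie between the outer two and are
    avoided by convexity, so the middle row is no boundary row. *)
Lemma boundary_rows_bounded :
  ~ (forall N, exists b, [/\ N <= b, past_avoids_right p b & boundary_row p b]).
Proof.
move=> h; have [b1 [_ a1 _]] := h 0.
have [b2 [lt12 a2 bd]] := h (b1 + 1); have [b3 [lt23 a3 _]] := h (b2 + 1).
by case: bd; apply; apply: (avoids_right_convex b1 _ b3) => //; lia.
Qed.

Lemma boundary_row_exists b0 b : past_avoids_right p b0 -> ~ past_avoids_right p b ->
  exists c, past_avoids_right p c /\ boundary_row p c.
Proof.
have h (k : nat) c : `|c - b| <= k%:Z -> past_avoids_right p c ->
    ~ past_avoids_right p b -> exists c, past_avoids_right p c /\ boundary_row p c.
  elim: k c => [|k IH] c cb ac nb.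
    by have e : c = b by [lia]; subst c.
  have [u|u] := pselect (past_avoids_right p (c + 1)); last by exists c; split=> //; left.
  have [d|d] := pselect (past_avoids_right p (c - 1)); last by exists c; split=> //; right.
  have [e|ne] := eqVneq c b; first by subst c.
  have [lt|gt] := lerP c b; first by apply: (IH (c + 1)) => //; lia.
  by apply: (IH (c - 1)) => //; lia.
by apply: (h `|b0 - b|%N); lia.
Qed.

End all_rows.

Lemma avoids_right_all_rows {p} : walk p -> recurrent p ->
  (forall b, exists i, (p i).2 = b) ->
  (exists b, past_avoids_right p b) -> forall b, past_avoids_right p b.
Proof.
move=> wp rp rows [b0 a0] b; apply: contrapT => nb.
have [c [ac bc]] := boundary_row_exists p b0 b a0 nb.
have [i ic] := rows c; move: ac; rewrite -ic => /(avoids_record i wp)[j [rj jc]].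
have [_ _ h] := rp.
have bj : either_end boundary_record p j by left; split=> //; rewrite jc ic.
have hits := h j bj.
have rows' b' : exists i, (rev p i).2 = b'.
  by have [k kb] := rows b'; exists (- k); rewrite /rev opprK.
(* Recurrence does not tell to which orientation a high boundary record belongs. If those of [p] do
   not occur above [N], all higher ones belong to [rev p], which is excluded in the same way. *)
apply: (boundary_rows_bounded p wp rp rows) => N.
apply: contrapT => hN.
apply: (boundary_rows_bounded _ (walk_rev wp) (recurrent_rev rp) rows') => N'.
have [k [[[rk bk]|[rk bk]] kN]] := hits (Order.max N N').
  by exfalso; apply: hN; exists (p k).2; split=> //; [lia|exact: record_avoids].
exists (rev p (- k)).2; split=> //; last exact: record_avoids.
by rewrite /rev opprK; lia.
Qed.

(** * Quarter turns and the four directions *)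

Definition turn (p : int -> Z2) : int -> Z2 := Defs.rot \o p.

Definition avoids_right (p : int -> Z2) := exists b, past_avoids_right p b.

(** Three counterclockwise quarter turns take up to right. Both conditions concern the past of [p],
    hence the same end. *)
Definition same_end_avoids_right_up (p : int -> Z2) :=
  avoids_right p /\ avoids_right (iter 3 turn p).

Lemma turn_rev k (p : int -> Z2) : iter k turn (rev p) = rev (iter k turn p).
Proof. by elim: k => //= k ->. Qed.

Lemma turn4 (p : int -> Z2) : iter 4 turn p = p.
Proof. by apply/funext => n /=; rewrite /= /turn /= /Defs.rot /= !opprK; case: (p n). Qed.

Lemma walk_turn k p : walk p -> walk (iter k turn p).
Proof.
move=> wp; elim: k => //= k [pinj padj]; split=> [m n|n] /=.
  by case: rot_bij => g gK _ /(can_inj gK)/pinj.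
by rewrite rot_adj.
Qed.

(** The first clause of [recurrent] for the turned walks makes the heights unbounded above and
    below; steps of size one then miss no row. *)
Lemma recurrent_rows p : walk p -> (forall k, recurrent (iter k turn p)) ->
  forall b, exists i, (p i).2 = b.
Proof.
move=> wp rp; apply: every_row => // N.
  have [h _ _] := rp 3; have [j [_]] := h 0 N.
  by rewrite /= /turn /= /Defs.rot /= => ?; exists j; lia.
have [h _ _] := rp 1; have [j [_]] := h 0 (- N).
by rewrite /= /turn /= /Defs.rot /= => ?; exists j; lia.
Qed.

(** Avoidance spreads to all rows, so avoidances witnessed on different rows can be compared on a
    common one. *)
Lemma avoids_right_excludes p : walk p -> (forall k, recurrent (iter k turn p)) ->
  avoids_right p -> ~ avoids_right (rev p) /\ ~ avoids_right (iter 2 turn p).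
Proof.
move=> wp rp [b a]; have r0 : recurrent p := rp 0.
have rows := recurrent_rows p wp rp.
have all := avoids_right_all_rows wp r0 rows (ex_intro _ b a).
split=> -[c].
  by have [i <-] := rows c; exact: avoids_right_one_end.
(* The half turn maps row [- c] to row [c] and exchanges left and right. *)
have [i ic] := rows (- c); move=> [N [M h]].
apply: (avoids_right_hits_left p wp r0 i (all _)).
exists N, (- M) => n nN nc; have := h n nN.
by rewrite /= /turn /= /Defs.rot /= nc ic opprK => /(_ erefl); lia.
Qed.

(* Opposite directions are avoided by different ends, so the end avoiding "up"
   is shared with exactly one of "left" and "right". *)
Lemma same_end_dichotomy p : walk p -> (forall k, recurrent (iter k turn p)) ->
  (forall k, avoids_right (iter k turn p) \/ avoids_right (iter k turn (rev p))) ->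
  let same q := same_end_avoids_right_up q \/ same_end_avoids_right_up (rev q) in
  same (turn p) <-> ~ same p.
Proof.
move=> wp rp av same.
have ex q k : q = p \/ q = rev p -> avoids_right (iter k turn q) ->
    ~ avoids_right (iter k turn (rev q)) /\ ~ avoids_right (iter k.+2 turn q).
  move=> qp a.
  have wq : walk q by case: qp => ->//; exact: walk_rev.
  rewrite turn_rev -[k.+2]/(2 + k)%N iterD; apply: avoids_right_excludes => //.
    exact: walk_turn.
  move=> j; rewrite -iterD; case: qp => ->//.
  by rewrite turn_rev; apply: recurrent_rev.
have s4 q : iter 3 turn (turn q) = q by rewrite -{2}(turn4 q).
(* The indices 0, 1 and 3 stand for right, down and up. Each is avoided by exactly one end, and up
   and down by different ends, so the end avoiding right avoids exactly one of up and down. *)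
pose A q k := avoids_right (iter k turn q).
have -> : same p = (A p 0 /\ A p 3 \/ A (rev p) 0 /\ A (rev p) 3) by [].
have -> : same (turn p) = (A p 1 /\ A p 0 \/ A (rev p) 1 /\ A (rev p) 0).
  by rewrite /same /same_end_avoids_right_up -(turn_rev 1) !s4.
have ex4 q : q = p \/ q = rev p -> A q 3 -> ~ A q 1.
  move=> qp a3 a1; have [_] := ex q 3 qp a3.
  by rewrite -[iter 5 turn q]/(turn (iter 4 turn q)) turn4.
have e1 := ex4 p (or_introl erefl); have e2 := ex4 _ (or_intror erefl).
have x0 := (ex p 0 (or_introl erefl)); have x1 := (ex p 1 (or_introl erefl)).
have x3 := (ex p 3 (or_introl erefl)).
have := av 0; have := av 1; have := av 3.
move: e1 e2 x0 x1 x3; rewrite -!/(A _ _) => *.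
tauto.
Qed.

(** * Parametrizations of paths *)

Definition parametrizes (p : int -> Z2) (P : bipath) :=
  [/\ injective p,
      forall u, pathV P u <-> exists n, p n = u &
      forall u v, pathE P (u, v) <->
        exists n m, [/\ p n = u, p m = v & `|n - m| = 1 :> int]].

Lemma direction_parametrizes {P t} : direction P t ->
  exists p, parametrizes p P /\ forall v, pathV P v -> p (t v) = v.
Proof.
move=> [[_ tinj tsurj] tE].
have /choice[p hp] n : exists v, pathV P v /\ t v = n.
  by have [v Vv <-] := tsurj n I; exists v.
have pK v : pathV P v -> p (t v) = v.
  move=> Vv; have [Vp tp] := hp (t v).
  by apply: tinj => //; exact: mem_set.
exists p; split=> //; split.
- by move=> m n e; rewrite -(hp m).2 -(hp n).2 e.
- by move=> u; split=> [Vu|[n <-]]; [exists (t u); exact: pK|exact: (hp n).1].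
- move=> u v; split=> [Euv|[n [m [<- <- nm]]]].
    have [Vu Vv _] := pathE_sub Euv.
    by exists (t u), (t v); rewrite !pK//; split=> //; apply/tE.
  by apply/tE; [exact: (hp n).1|exact: (hp m).1|rewrite (hp n).2 (hp m).2].
Qed.

Lemma parametrization P : exists p, parametrizes p P.
Proof. by have [t /direction_parametrizes[p [? _]]] := path_iso P; exists p. Qed.

Lemma parametrizes_walk {p P} : parametrizes p P -> walk p.
Proof.
move=> [pinj _ pE]; split=> // n.
suff /pathE_sub[] : pathE P (p n, p (n + 1)) by [].
by apply/pE; exists n, (n + 1); split=> //; lia.
Qed.

Lemma parametrizes_rev {p P} : parametrizes p P -> parametrizes (rev p) P.
Proof.
move=> [pinj pV pE]; split.
- by move=> m n /pinj/oppr_inj.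
- move=> u; rewrite pV; split=> -[n <-]; exists (- n); rewrite /rev ?opprK//.
- move=> u v; rewrite pE; split=> -[n [m [<- <- nm]]]; exists (- n), (- m);
    by rewrite /rev ?opprK//; split=> //; lia.
Qed.

Lemma parametrizes_image {f} (fb : bijective f) fadj {p P} : parametrizes p P ->
  parametrizes (f \o p) (path_image fb fadj P).
Proof.
have [g fK _] := fb; move=> [pinj pV pE]; split.
- by move=> m n /(can_inj fK)/pinj.
- move=> u; split=> [[v /pV[n <-] <-]|[n <-]]; first by exists n.
  by exists (p n) => //; apply/pV; exists n.
- move=> u v; split=> [[[a b] /pE[n [m [<- <- nm]]] [<- <-]]|[n [m [<- <- nm]]]].
    by exists n, m.
  by exists (p n, p m) => //; apply/pE; exists n, m.
Qed.

Lemma parametrizes_translate z {p P} : parametrizes p P ->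
  parametrizes (shift z \o p) (translate z P).
Proof. exact: parametrizes_image. Qed.

Lemma parametrizes_rotate k {p P} : parametrizes p P ->
  parametrizes (iter k turn p) (rotate_path k P).
Proof. by move=> pP; elim: k => //= k; exact: parametrizes_image. Qed.

(* [u] is the [k]-th vertex visited after [w] by the walk along [P] that
   starts with the edge from [v] to [w]. *)
Fixpoint reaches (k : nat) (v w u : Z2) (P : bipath) : Prop :=
  pathE P (v, w) /\
  if k is k'.+1 then exists w', w' <> v /\ reaches k' w w' u P else u = w.

(** A vertex of the path has only two neighbours in it, so after the first edge the condition
    [w' <> v] leaves a single way to go on, namely along the past of [p i]. *)
Lemma reachesP {p P} : parametrizes p P -> forall k i u,
  reaches k (p i) (p (i - 1)) u P <-> u = p (i - 1 - k%:Z).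
Proof.
move=> [pinj pV pE]; have E i : pathE P (p i, p (i - 1)).
  by apply/pE; exists i, (i - 1); split=> //; lia.
elim=> [|k IH] i u /=; first by rewrite subr0; split=> [[]|].
have -> : i - 1 - k.+1%:Z = i - 1 - 1 - k%:Z by lia.
rewrite -IH; split=> [[_ [w [wi h]]]|h].
  have [m ew mi] : exists2 m, w = p m & `|i - 1 - m| = 1.
    have : pathE P (p (i - 1), w) by case: (k) h => [|?] [].
    by move=> /pE[n [m [/pinj -> <- nm]]]; exists m.
  have -> : p (i - 1 - 1) = w; last by [].
  have [mi'|mi'] := eqVneq m i; first by case: wi; rewrite ew mi'.
  by rewrite ew; congr p; lia.
split=> //; exists (p (i - 1 - 1)); split=> // /pinj; lia.
Qed.

(** Both neighbours are written as predecessors, one in [p] and one in [rev p], so that choosing an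
    edge at [v] amounts to choosing which end is called the past. *)
Lemma edgeP {p P v w} : parametrizes p P -> pathE P (v, w) <->
  exists i, p i = v /\ (w = p (i - 1) \/ w = rev p (- i - 1)).
Proof.
move=> [_ _ pE]; rewrite pE; split=> [[n [m [<- <- nm]]]|[n [<- h]]].
  exists n; split=> //; have [nm'|nm'] := leP n m; [right|left]; rewrite /rev; congr p; lia.
by case: h => ->; [exists n, (n - 1)|exists n, (n + 1)];
  split=> //; rewrite /rev ?opprB ?opprK 1?addrC//; lia.
Qed.

(** * Measurability and recurrence *)

Section measurable_predicates.
Context {d : measure_display} {T : measurableType d}.
Implicit Types F G : T -> Prop.

Definition measurable_pred F := measurable [set x | F x].

Lemma measurable_pred_exists {I : countType} (F : I -> T -> Prop) :
  (forall i, measurable_pred (F i)) -> measurable_pred (fun x => exists i, F i x).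
Proof.
move=> mF; rewrite /measurable_pred.
have -> : [set x | exists i, F i x] = \bigcup_i [set x | F i x].
  by apply/seteqP; split=> x [i]; [exists i|exists i].
exact: countable_bigcupT_measurable.
Qed.

Lemma measurable_pred_not F : measurable_pred F -> measurable_pred (fun x => ~ F x).
Proof. exact: measurableC. Qed.

Lemma measurable_pred_and F G : measurable_pred F -> measurable_pred G ->
  measurable_pred (fun x => F x /\ G x).
Proof. exact: measurableI. Qed.

Lemma measurable_pred_or F G : measurable_pred F -> measurable_pred G ->
  measurable_pred (fun x => F x \/ G x).
Proof. exact: measurableU. Qed.

Lemma measurable_pred_const (Q : Prop) : measurable_pred (fun=> Q).
Proof.
have [q|nq] := pselect Q.
  rewrite /measurable_pred (_ : [set _ | Q] = setT); first exact: measurableT.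
  by apply/seteqP; split.
rewrite /measurable_pred (_ : [set _ | Q] = set0); first exact: measurable0.
by apply/seteqP; split.
Qed.

Lemma measurable_pred_imply F G : measurable_pred F -> measurable_pred G ->
  measurable_pred (fun x => F x -> G x).
Proof.
move=> mF mG.
have -> : (fun x => F x -> G x) = (fun x => ~ F x \/ G x).
  by apply/funext => x; apply/propext; rewrite implyE.
by apply: measurable_pred_or => //; exact: measurable_pred_not.
Qed.

Lemma measurable_pred_forall {I : countType} (F : I -> T -> Prop) :
  (forall i, measurable_pred (F i)) -> measurable_pred (fun x => forall i, F i x).
Proof.
move=> mF.
have -> : (fun x => forall i, F i x) = (fun x => ~ exists i, ~ F i x).
  apply/funext => x; apply/propext; split=> [h [i]|h i]; first by apply.
  by apply: contrapT => nF; apply: h; exists i.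
by apply/measurable_pred_not/measurable_pred_exists => i; exact: measurable_pred_not.
Qed.

End measurable_predicates.

Section recurrence.
Context {d : measure_display} {T : measurableType d} {R : realType}.
Variables (mu : probability T R) (f : T -> T).
Hypothesis f_meas : forall A, measurable A -> measurable (f @^-1` A).
Hypothesis f_inv : forall A, measurable A -> mu (f @^-1` A) = mu A.

Lemma ae_preimage (F : T -> Prop) :
  {ae mu, forall x, F x} -> {ae mu, forall x, F (f x)}.
Proof.
move=> [A [mA A0 FA]]; exists (f @^-1` A); split.
- exact: f_meas.
- by rewrite -A0; exact: f_inv.
- by move=> x; apply: FA.
Qed.

Lemma iter_preimage n A : measurable A ->
  measurable (iter n f @^-1` A) /\ mu (iter n f @^-1` A) = mu A.
Proof.
elim: n A => [//|n IH] A mA.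
have [m e] := IH _ (f_meas A mA).
by rewrite -(f_inv A mA) -e.
Qed.

(** The preimages of [B] under the iterates are pairwise disjoint and all have mass [mu B]; if this
    were positive, finitely many of them would exceed the total mass 1. *)
Lemma wandering_null B : measurable B ->
  (forall x n, B x -> ~ B (iter n.+1 f x)) -> mu B = 0%E.
Proof.
move=> mB wB.
have mF i : setT i -> measurable (iter i f @^-1` B) by move=> _; exact: (iter_preimage i B mB).1.
have tF : trivIset setT (fun i => iter i f @^-1` B).
  have h x i k : (iter i f @^-1` B) x -> (iter (k.+1 + i) f @^-1` B) x -> False.
    by move=> Bi; rewrite -[X in X -> _]/(B (iter (k.+1 + i) f x)) iterD; exact: wB.
  apply/trivIsetP => i j _ _ ij; apply/seteqP; split=> // x [Bi Bj].
  have [lt|gt] := ltnP i j.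
    by apply: (h x i (j - i).-1 Bi); have -> : ((j - i).-1.+1 + i)%N = j by lia.
  by apply: (h x j (i - j).-1 Bj); have -> : ((i - j).-1.+1 + j)%N = i by [lia].
have := probability_le1 mu (bigcup_measurable mF).
rewrite measure_bigcup//.
rewrite (eq_eseriesr (fun i _ => (iter_preimage i B mB).2)).
move=> le1.
have fin : mu B \is a fin_num by exact: fin_num_measure.
rewrite -(fineK fin); congr (_%:E); apply/eqP; rewrite eq_le fine_ge0 ?measure_ge0// andbT.
rewrite leNgt; apply/negP => c0.
pose n := Num.bound (fine (mu B))^-1.
have : (\sum_(0 <= i < n | i \in [set: nat]) mu B <= 1)%E.
  by apply: le_trans le1; apply: nneseries_lim_ge => *; exact: measure_ge0.
rewrite -(fineK fin) sumEFin lee_fin.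
under eq_bigl do rewrite in_setT.
rewrite sumr_const_nat subn0 -mulr_natr.
have := archi_boundP (ltW (_ : 0 < (fine (mu B))^-1)).
rewrite invr_gt0 => /(_ c0); rewrite -/n => hn.
by apply/negP; rewrite -ltNge mulrC -ltr_pdivrMr// div1r.
Qed.

(** A point of [W] with finitely many visits is carried, at its last visit, into the set [B] of
    points of [W] that never return. [B] is wandering, so its countably many preimages are null. *)
Lemma poincare_recurrence (W : T -> Prop) : measurable_pred W ->
  {ae mu, forall x, W x -> forall N, exists n, (N <= n)%N /\ W (iter n f x)}.
Proof.
move=> mW; pose B := [set x | W x /\ forall n, ~ W (iter n.+1 f x)].
have mB : measurable B.
  apply: measurable_pred_and => //; apply: measurable_pred_forall => n.
  by apply: measurable_pred_not; exact: (iter_preimage n.+1 _ mW).1.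
have B0 : mu B = 0%E by apply: wandering_null => // x n [_ h] [/h].
suff h : mu.-negligible (\bigcup_n (iter n f @^-1` B)).
  apply: negligibleS h => x /= /not_implyP[Wx /existsNP[N nN]].
  have {}nN n : (N <= n)%N -> ~ W (iter n f x).
    by move=> Nn Wn; apply: nN; exists n.
  elim: N nN => [|N IH] nN; first by case: (nN 0%N).
  have [WN|WN] := pselect (W (iter N f x)).
    exists N => //; split=> // n; rewrite -iterD; apply: nN; lia.
  apply: IH => n; rewrite leq_eqVlt => /orP[/eqP <- //|]; exact: nN.
apply: negligible_bigcup => n; have [m e] := iter_preimage n B mB.
by exists (iter n f @^-1` B); split=> //; rewrite -B0; exact: e.
Qed.

End recurrence.

Lemma measurable_vertex v : @measurable_pred _ path_space (fun P => pathV P v).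
Proof. by apply: sub_sigma_algebra; left; exists v. Qed.

Lemma measurable_edge e : @measurable_pred _ path_space (fun P => pathE P e).
Proof. by apply: sub_sigma_algebra; right; exists e. Qed.

Lemma path_image_measurable f (fb : bijective f) fadj (A : set path_space) :
  measurable A -> measurable ((path_image fb fadj : path_space -> path_space) @^-1` A).
Proof.
move=> mA; rewrite -[X in measurable X]setTI.
suff mf : measurable_fun setT (path_image fb fadj : path_space -> path_space).
  exact: mf.
apply: (@measurability _ _ path_space path_space setT _ path_cylinders) => //.
have [g fK gK] := fb.
move=> _ [_ [[v _ <-]|[[u v] _ <-]] <-]; rewrite setTI.
  have -> : path_image fb fadj @^-1` [set P | pathV P v] = [set P | pathV P (g v)].
    apply/seteqP; split=> P /=; first by move=> [u Vu <-]; rewrite fK.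
    by exists (g v).
  exact: measurable_vertex.
have -> : path_image fb fadj @^-1` [set P | pathE P (u, v)] = [set P | pathE P (g u, g v)].
  apply/seteqP; split=> P /=.
    by move=> [[a b] Eab [<- <-]]; rewrite !fK.
  by move=> E; exists (g u, g v) => //=; rewrite !gK.
exact: measurable_edge.
Qed.

Lemma measurable_reaches k v w u : @measurable_pred _ path_space (reaches k v w u).
Proof.
elim: k v w => [|k IH] v w /=;
    apply: measurable_pred_and; try exact: measurable_edge.
  exact: measurable_pred_const.
apply: measurable_pred_exists => w'.
by apply: measurable_pred_and => //; exact: measurable_pred_const.
Qed.

(** * Events of the path space *)

(** These events choose no parametrization: the edge from [v] to [w] selects an end, and countable
    quantifiers over [reaches] keep everything measurable. *)
Definition record_via (v w : Z2) (P : bipath) :=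
  forall k u, reaches k v w u P -> u.2 = v.2 -> u.1 <= v.1.

(** The map [g] allows the row to be taken in a rotated picture. A bound on the whole walk from [w]
    on is equivalent to one on its distant part. *)
Definition avoids_via (g : Z2 -> Z2) (v w : Z2) (b : int) (P : bipath) :=
  exists M : int, forall k u, reaches k v w u P -> (g u).2 = b -> (g u).1 <= M.

Definition boundary_record_via (v w : Z2) (P : bipath) :=
  record_via v w P /\
  (~ avoids_via id v w (v.2 + 1) P \/ ~ avoids_via id v w (v.2 - 1) P).

Definition avoids_right_via (v w : Z2) (P : bipath) :=
  exists b, avoids_via id v w b P.

(* Three quarter turns take the upward direction to the right. *)
Definition same_end_via (v w : Z2) (P : bipath) :=
  avoids_right_via v w P /\ (exists b, avoids_via (iter 3 Defs.rot) v w b P).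

Lemma record_viaP p P i : parametrizes p P ->
  record_via (p i) (p (i - 1)) P <-> record p i.
Proof.
move=> pP; split=> [h m mi|h k u /(reachesP pP) ->]; last by apply: h; lia.
apply: (h `|(i - 1 - m)%R|%N (p m)); apply/(reachesP pP); congr p; lia.
Qed.

Lemma avoids_viaP g p P i b : parametrizes p P -> walk (g \o p) ->
  avoids_via g (p i) (p (i - 1)) b P <-> past_avoids_right (g \o p) b.
Proof.
move=> pP wp; split=> [[M h]|/(past_avoids_right_from wp)/(_ (i - 1))[M h]].
  exists (i - 1), M => n ni; apply: (h `|(i - 1 - n)%R|%N (p n)).
  by apply/(reachesP pP); congr p; lia.
by exists M => k u /(reachesP pP) ->; apply: h; lia.
Qed.

Lemma boundary_record_viaP p P i : parametrizes p P ->
  boundary_record_via (p i) (p (i - 1)) P <-> boundary_record p i.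
Proof.
move=> pP; have wp := parametrizes_walk pP.
by rewrite /boundary_record_via record_viaP// !avoids_viaP.
Qed.

Lemma avoids_right_viaP p P i : parametrizes p P ->
  avoids_right_via (p i) (p (i - 1)) P <-> avoids_right p.
Proof.
move=> pP; have wp := parametrizes_walk pP.
by split=> -[b h]; exists b; move: h; rewrite avoids_viaP.
Qed.

Lemma same_end_viaP p P i : parametrizes p P ->
  same_end_via (p i) (p (i - 1)) P <-> same_end_avoids_right_up p.
Proof.
move=> pP; have wp := parametrizes_walk pP.
have E1 b : avoids_via id (p i) (p (i - 1)) b P <-> past_avoids_right p b.
  exact: (avoids_viaP id p P i b pP wp).
have E3 b : avoids_via (iter 3 Defs.rot) (p i) (p (i - 1)) b P <->
    past_avoids_right (iter 3 turn p) b.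
  exact: (avoids_viaP (iter 3 Defs.rot) p P i b pP (walk_turn 3 p wp)).
by split=> -[[b hb] [c hc]]; split;
  [exists b; exact/E1|exists c; exact/E3|exists b; exact/E1|exists c; exact/E3].
Qed.

(** The two edges of the path at [v] correspond to the two alternatives of [either_end]. *)
Lemma edge_eventP {Phi : Z2 -> Z2 -> bipath -> Prop} {Q : (int -> Z2) -> int -> Prop} :
  (forall p P i, parametrizes p P -> Phi (p i) (p (i - 1)) P <-> Q p i) ->
  forall {p P} v, parametrizes p P ->
  (exists w, pathE P (v, w) /\ Phi v w P) <-> exists i, p i = v /\ either_end Q p i.
Proof.
move=> PhiQ p P v pP; have rP := parametrizes_rev pP.
have E := edgeP pP; split.
  move=> [w [/E[i [<- [->|->]]] h]]; exists i; split=> //; [left|right].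
    by apply/(PhiQ _ _ _ pP).
  by apply/(PhiQ _ _ _ rP); rewrite {1}/rev opprK.
move=> [i [<- [h|h]]].
  by exists (p (i - 1)); split; [apply/E; exists i; split=> //; left|apply/(PhiQ _ _ _ pP)].
exists (rev p (- i - 1)); split; first by apply/E; exists i; split=> //; right.
have -> : p i = rev p (- i) by rewrite /rev opprK.
by apply/(PhiQ _ _ _ rP).
Qed.

Definition translation_covariant (F : Z2 -> bipath -> Prop) :=
  forall z v P, F (shift z v) (translate z P) <-> F v P.

Lemma vertex_covariant : translation_covariant (fun v P => pathV P v).
Proof.
move=> z v P; split=> [[u Vu]|Vv]; last by exists v.
by have [g fK _] := shift_bij z; move/(can_inj fK) <-.
Qed.

(** Translating a parametrization reduces covariance of the event to translation invariance of the
    walk property [Q]. *)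
Lemma edge_event_covariant Phi Q :
  (forall p P i, parametrizes p P -> Phi (p i) (p (i - 1)) P <-> Q p i) ->
  (forall z p i, Q (shift z \o p) i <-> Q p i) ->
  translation_covariant (fun v P => exists w, pathE P (v, w) /\ Phi v w P).
Proof.
move=> PhiQ Qz z v P; have [p pP] := parametrization P.
have [g fK _] := shift_bij z.
rewrite (edge_eventP PhiQ _ pP) (edge_eventP PhiQ _ (parametrizes_translate z pP)).
split=> -[i [/= pv h]]; exists i; split=> /=.
- exact: (can_inj fK).
- by move: h; rewrite /either_end -[rev (_ \o _)]/(shift z \o rev p) !Qz.
- by rewrite pv.
- by rewrite /either_end -[rev (_ \o _)]/(shift z \o rev p) !Qz.
Qed.

Lemma past_avoids_right_shift z p b :
  past_avoids_right (shift z \o p) (b + z.2) <-> past_avoids_right p b.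
Proof.
split=> -[N [M h]].
  exists N, (M - z.1) => n nN nb.
  by have := h n nN; rewrite /= nb => /(_ erefl); lia.
by exists N, (M + z.1) => n nN /= nb; have := h n nN; lia.
Qed.

Lemma record_shift z p i : record (shift z \o p) i <-> record p i.
Proof. by split=> h m mi /= e; have := h m mi; rewrite /=; lia. Qed.

Lemma boundary_record_shift z p i :
  boundary_record (shift z \o p) i <-> boundary_record p i.
Proof.
rewrite /boundary_record record_shift /boundary_row /=.
have -> : (p i).2 + z.2 + 1 = (p i).2 + 1 + z.2 by lia.
have -> : (p i).2 + z.2 - 1 = (p i).2 - 1 + z.2 by lia.
by rewrite !past_avoids_right_shift.
Qed.

Lemma measurable_record_via v w : @measurable_pred _ path_space (record_via v w).
Proof.
do 2 (apply: measurable_pred_forall => ?).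
by apply: measurable_pred_imply; [exact: measurable_reaches|exact: measurable_pred_const].
Qed.

Lemma measurable_avoids_via g v w b :
  @measurable_pred _ path_space (avoids_via g v w b).
Proof.
apply: measurable_pred_exists => M; do 2 (apply: measurable_pred_forall => ?).
by apply: measurable_pred_imply; [exact: measurable_reaches|exact: measurable_pred_const].
Qed.

Lemma measurable_edge_event (Phi : Z2 -> Z2 -> bipath -> Prop) v :
  (forall w, @measurable_pred _ path_space (Phi v w)) ->
  @measurable_pred _ path_space (fun P => exists w, pathE P (v, w) /\ Phi v w P).
Proof.
move=> m; apply: measurable_pred_exists => w.
by apply: measurable_pred_and => //; exact: measurable_edge.
Qed.

Lemma measurable_boundary_record_via v w :
  @measurable_pred _ path_space (boundary_record_via v w).
Proof.
apply: measurable_pred_and; first exact: measurable_record_via.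
by apply: measurable_pred_or; apply: measurable_pred_not; exact: measurable_avoids_via.
Qed.

Lemma measurable_same_end_via v w : @measurable_pred _ path_space (same_end_via v w).
Proof.
by apply: measurable_pred_and; apply: measurable_pred_exists => b;
  exact: measurable_avoids_via.
Qed.

(** * Almost sure recurrence and ergodicity *)

Section invariant_measure.
Context {R : realType} (mu : probability path_space R).
Hypotheses (mu_transl : translation_invariant mu)
  (mu_ergodic : translation_ergodic mu) (mu_rot : rotation_invariant mu).

Lemma ae_countable_forall {I : countType} (F : I -> path_space -> Prop) :
  (forall i, {ae mu, forall P, F i P}) -> {ae mu, forall P, forall i, F i P}.
Proof.
move=> h.
have {}h : {ae mu, forall P, forall n, if unpickle n is Some i then F i P else True}.
  by apply: ae_foralln => n; case: unpickle => [i|]; [exact: h|exact: aeW].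
apply: filterS h => P h i; have := h (pickle i); by rewrite pickleK.
Qed.

(** Translating the path [n] times by [- e] brings its vertex [v + n e] to [v], so returns of the
    event at [v] are occurrences of [F] along the line from [v] in direction [e]. *)
Lemma recurrence (F : Z2 -> bipath -> Prop) (e : Z2) :
  (forall v, @measurable_pred _ path_space (F v)) -> translation_covariant F ->
  {ae mu, forall P, forall v, F v P -> forall N : nat,
    exists n : nat, (N <= n)%N /\ F (v.1 + e.1 *+ n, v.2 + e.2 *+ n) P}.
Proof.
move=> mF cF; apply: ae_countable_forall => v.
pose f : path_space -> path_space := translate (- e.1, - e.2).
have fm A : measurable A -> measurable (f @^-1` A) by exact: path_image_measurable.
have h := poincare_recurrence mu f fm (mu_transl _) (F v) (mF v).
apply: filterS h => P h /h{}h N; have [n [Nn hn]] := h N.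
exists n; split=> //; move: hn.
elim: n v {Nn h mF} => [|n IH] v; first by rewrite !addr0; case: v.
rewrite iterS => hn.
have -> : (v.1 + e.1 *+ n.+1, v.2 + e.2 *+ n.+1) =
    ((v.1 + e.1) + e.1 *+ n, (v.2 + e.2) + e.2 *+ n) by rewrite !mulrS !addrA.
apply: (IH (v.1 + e.1, v.2 + e.2)).
apply/(cF (- e.1, - e.2)); rewrite /shift /= !addrK.
by case: v hn.
Qed.

Lemma ae_recurrent : {ae mu, forall P : path_space, forall p, parametrizes p P -> recurrent p}.
Proof.
have h1 := recurrence (fun v P => pathV P v) (1, 0) measurable_vertex vertex_covariant.
have h2 := recurrence _ (-1, 0)
  (fun v => measurable_edge_event _ v (measurable_record_via v))
  (edge_event_covariant _ _ record_viaP record_shift).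
have h3 := recurrence _ (0, 1)
  (fun v => measurable_edge_event _ v (measurable_boundary_record_via v))
  (edge_event_covariant _ _ boundary_record_viaP boundary_record_shift).
apply: (filterS3 (ae_filter_ringOfSetsType mu) _ h1 h2 h3) => P {}h1 {}h2 {}h3 p pP.
have [_ pV _] := pP; split=> i.
- move=> N; have Vi : pathV P (p i) by apply/pV; exists i.
  have [n [Nn /pV[j ej]]] := h1 _ Vi `|N - (p i).1|%N.
  by exists j; rewrite ej /= mul0rn addr0; split=> //; lia.
- move=> ri N.
  have /h2/(_ `|N - (p i).1|%N)[n [Nn]] : exists w, pathE P (p i, w) /\ record_via (p i) w P.
    by apply/(edge_eventP record_viaP _ pP); exists i.
  move/(edge_eventP record_viaP _ pP) => [j [ej rj]].
  by exists j; rewrite ej /= mul0rn addr0; split=> //; lia.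
- move=> ri N.
  have /h3/(_ `|N - (p i).2|%N)[n [Nn]] :
      exists w, pathE P (p i, w) /\ boundary_record_via (p i) w P.
    by apply/(edge_eventP boundary_record_viaP _ pP); exists i.
  move/(edge_eventP boundary_record_viaP _ pP) => [j [ej rj]].
  by exists j; rewrite ej /=; split=> //; lia.
Qed.

Lemma ae_rotate k (F : path_space -> Prop) :
  {ae mu, forall P, F P} -> {ae mu, forall P : path_space, F (rotate_path k P)}.
Proof.
elim: k F => [//|k IH] F h.
apply: (IH (fun P => F (rotate_path 1 P))).
apply: (ae_preimage mu (rotate_path 1 : path_space -> path_space)) => //.
  exact: (path_image_measurable _ rot_bij rot_adj).
exact: mu_rot.
Qed.

Lemma zero_one (F : path_space -> Prop) : measurable_pred F ->
  (forall z P, F (translate z P) <-> F P) ->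
  {ae mu, forall P, ~ F P} \/ {ae mu, forall P, F P}.
Proof.
move=> mF Fz.
have [|F0|F1] := mu_ergodic _ mF.
- by move=> z; apply/seteqP; split=> P h; apply/(Fz z).
- by left; exists [set P | F P]; split=> // P /= /contrapT.
right; exists (~` [set P | F P]); split=> //; first exact: measurableC.
by rewrite probability_setC// F1 subee.
Qed.

Lemma ae_absurd : ~ {ae mu, forall P : path_space, False}.
Proof.
move=> [A [mA A0 TA]]; have AT : A = setT by apply/seteqP; split=> // P _; apply: TA => -[].
have := probability_setT mu; rewrite -AT => A1.
have : (0%E : \bar R) = 1%E by rewrite -A0 -A1.
by move/eqP; rewrite eq_sym onee_eq0.
Qed.

(** Ranging over all edges removes the dependence on a base point and on the orientation, so the
    event is translation invariant and ergodicity applies. *)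
Definition avoids_event (P : path_space) :=
  exists v w, pathE P (v, w) /\ avoids_right_via v w P.

Definition same_end_event (P : path_space) :=
  exists v w, pathE P (v, w) /\ same_end_via v w P.

Lemma avoids_eventP p P : parametrizes p P ->
  avoids_event P <-> avoids_right p \/ avoids_right (rev p).
Proof.
move=> pP.
have E v := edge_eventP (Q := fun q _ => avoids_right q) avoids_right_viaP v pP.
split=> [[v /E[i [_]]] //|h].
by exists (p 0); apply/E; exists 0.
Qed.

Lemma same_end_eventP p P : parametrizes p P ->
  same_end_event P <-> same_end_avoids_right_up p \/ same_end_avoids_right_up (rev p).
Proof.
move=> pP.
have E v := edge_eventP (Q := fun q _ => same_end_avoids_right_up q) same_end_viaP v pP.
split=> [[v /E[i [_]]] //|h].
by exists (p 0); apply/E; exists 0.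
Qed.

Lemma avoids_right_shift z p : avoids_right (shift z \o p) <-> avoids_right p.
Proof.
split=> -[b h]; last by exists (b + z.2); exact/past_avoids_right_shift.
by exists (b - z.2); apply/(past_avoids_right_shift z); rewrite subrK.
Qed.

Lemma turn_shift z p : exists z', turn (shift z \o p) = shift z' \o turn p.
Proof.
by exists (- z.2, z.1); apply/funext => n; rewrite /turn /Defs.rot /shift /= opprD.
Qed.

Lemma same_end_shift z p :
  same_end_avoids_right_up (shift z \o p) <-> same_end_avoids_right_up p.
Proof.
rewrite /same_end_avoids_right_up /=.
have [z1 ->] := turn_shift z p; have [z2 ->] := turn_shift z1 (turn p).
have [z3 ->] := turn_shift z2 (turn (turn p)).
by rewrite !avoids_right_shift.
Qed.

Lemma ae_avoids_no_direction :
  {ae mu, forall P, ~ avoids_event P}.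
Proof.
have mE : measurable_pred avoids_event.
  apply: measurable_pred_exists => v; apply: measurable_edge_event => w.
  by apply: measurable_pred_exists => b; exact: measurable_avoids_via.
have mS : measurable_pred same_end_event.
  apply: measurable_pred_exists => v; apply: measurable_edge_event => w.
  exact: measurable_same_end_via.
have [z P|//|av] := zero_one _ mE.
  have [p pP] := parametrization P.
  rewrite (avoids_eventP p P pP) (avoids_eventP _ _ (parametrizes_translate z pP)).
  by rewrite -[rev (_ \o _)]/(shift z \o rev p) !avoids_right_shift.
exfalso.
have rec : {ae mu, forall P : path_space, forall p, parametrizes p P ->
    forall k, recurrent (iter k turn p)}.
  have : {ae mu, forall P : path_space,
      forall k p, parametrizes p (rotate_path k P) -> recurrent p}.
    apply: ae_countable_forall => k.
    exact: (ae_rotate k (fun P => forall p, parametrizes p P -> recurrent p) ae_recurrent).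
  by apply: filterS => P h p pP k; apply: (h k); exact: parametrizes_rotate.
have {}av : {ae mu, forall P : path_space, forall k, avoids_event (rotate_path k P)}.
  by apply: ae_countable_forall => k; exact: (ae_rotate k avoids_event av).
have dich : {ae mu, forall P : path_space,
    same_end_event (rotate_path 1 P) <-> ~ same_end_event P}.
  apply: (filterS2 (ae_filter_ringOfSetsType mu) _ rec av) => P {}rec {}av.
  have [p pP] := parametrization P.
  rewrite (same_end_eventP p P pP).
  rewrite (same_end_eventP _ _ (parametrizes_rotate 1 pP)).
  apply: same_end_dichotomy (parametrizes_walk pP) (rec p pP) _ => k.
  by rewrite turn_rev; apply/(avoids_eventP _ _ (parametrizes_rotate k pP)).
apply: ae_absurd.
(* Whichever truth value is almost sure, rotation invariance gives the same one to the quarter turn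
   of the path, where [dich] demands the opposite. *)
have [z P|S0|S1] := zero_one _ mS.
- have [p pP] := parametrization P.
  rewrite (same_end_eventP p P pP) (same_end_eventP _ _ (parametrizes_translate z pP)).
  by rewrite -[rev (_ \o _)]/(shift z \o rev p) !same_end_shift.
- by apply: (filterS3 (ae_filter_ringOfSetsType mu) _ dich S0 (ae_rotate 1 _ S0)) =>
    P d s /(_ (d.2 s)).
- by apply: (filterS3 (ae_filter_ringOfSetsType mu) _ dich S1 (ae_rotate 1 _ S1)) =>
    P d s /d /(_ s).
Qed.

End invariant_measure.

(** * Infinitely many visits to each ray *)

Lemma unbounded_infinite (g : Z2 -> int) (A : set Z2) :
  (forall M, exists u, A u /\ M < g u) -> infinite_set A.
Proof.
move=> h fA; have [N hN] := finite_int_lower_bound _ (finite_image (fun u => - g u) fA).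
have [u [Au uN]] := h (- N); apply: (hN (- g u)); first by lia.
by exists u.
Qed.

Lemma iter_turnE k p n : iter k turn p n = iter k Defs.rot (p n).
Proof. by elim: k => //= k IH; rewrite /turn /= IH. Qed.

(** One argument serves all four rays: [k] quarter turns bring the ray to the right, where the row
    of the turned [v] is visited arbitrarily far out, at times before [N]. *)
Lemma infinite_ray k p N (v : Z2) (A D : set Z2) :
  ~ avoids_right (iter k turn p) -> (forall n, n <= N -> A (p n)) ->
  (forall u, (iter k Defs.rot u).2 = (iter k Defs.rot v).2 ->
    (iter k Defs.rot v).1 < (iter k Defs.rot u).1 -> D u) ->
  infinite_set (A `&` D).
Proof.
move=> na pA vD; apply: (unbounded_infinite (fun u => (iter k Defs.rot u).1)) => M.
have nb : ~ past_avoids_right (iter k turn p) (iter k Defs.rot v).2.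
  by move=> h; apply: na; exists (iter k Defs.rot v).2.
have [n []] := past_avoids_right_not nb N (Order.max M (iter k Defs.rot v).1).
rewrite iter_turnE => nN nv nM; exists (p n); split; last by lia.
by split; [exact: pA|apply: vD => //; lia].
Qed.

Lemma infinite_rays p N (v : Z2) (A : set Z2) :
  (forall k, ~ avoids_right (iter k turn p)) -> (forall n, n <= N -> A (p n)) ->
  [/\ infinite_set (A `&` ray_up v), infinite_set (A `&` ray_down v),
      infinite_set (A `&` ray_right v) & infinite_set (A `&` ray_left v)].
Proof.
move=> na pA; split.
(* Up, down, right and left become right after 3, 1, 0 and 2 quarter turns. *)
- apply: (infinite_ray 3 p N v) => // -[x y]; rewrite /= /Defs.rot /= => e l.
  by exists y => /=; [lia|congr pair; lia].
- apply: (infinite_ray 1 p N v) => // -[x y]; rewrite /= /Defs.rot /= => e l.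
  by exists y => /=; [lia|congr pair; lia].
- apply: (infinite_ray 0 p N v) => // -[x y]; rewrite /= /Defs.rot /= => e l.
  by exists x => /=; [lia|congr pair; lia].
- apply: (infinite_ray 2 p N v) => // -[x y]; rewrite /= /Defs.rot /= => e l.
  by exists x => /=; [lia|congr pair; lia].
Qed.

Theorem theorem1 (R : realType) (mu : probability path_space R)
    (mu_transl : translation_invariant mu)
    (mu_ergodic : translation_ergodic mu)
    (mu_rot : rotation_invariant mu) :
  {ae mu, forall P : path_space, forall (t : Z2 -> int) (v : Z2),
     direction P t -> pathV P v ->
     [/\ infinite_set (past P t v `&` ray_up v),
         infinite_set (past P t v `&` ray_down v),
         infinite_set (past P t v `&` ray_right v) &
         infinite_set (past P t v `&` ray_left v)] /\
     [/\ infinite_set (future P t v `&` ray_up v),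
         infinite_set (future P t v `&` ray_down v),
         infinite_set (future P t v `&` ray_right v) &
         infinite_set (future P t v `&` ray_left v)]}.
Proof.
have : {ae mu, forall P : path_space, forall k, ~ avoids_event (rotate_path k P)}.
  apply: ae_countable_forall => k; apply: (ae_rotate mu mu_rot k (fun P => ~ avoids_event P)).
  exact: ae_avoids_no_direction.
apply: filterS => P na t v tP Vv.
have [p [pP pt]] := direction_parametrizes tP.
have [pinj pV _] := pP.
have Vp n : pathV P (p n) by apply/pV; exists n.
have tp n : t (p n) = n by apply: pinj; exact: pt.
have {}na k : ~ avoids_right (iter k turn p) /\ ~ avoids_right (iter k turn (rev p)).
  rewrite turn_rev; apply/not_orP.
  by move/(avoids_eventP _ _ (parametrizes_rotate k pP)); exact: na.
split.
(* Since [t] inverts [p], the past of [v] is the set of times up to [t v - 1]; in [rev p] its future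
   is the set of times up to [- t v - 1]. *)
- apply: (infinite_rays p (t v - 1)) => [k|n nv]; first exact: (na k).1.
  by split; rewrite ?tp//; lia.
- apply: (infinite_rays (rev p) (- t v - 1)) => [k|n nv]; first exact: (na k).2.
  by split; rewrite /rev ?tp//; lia.
Qed.
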